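(* Let $s_1,\dots,s_N$ be independent (integrable, real-valued) random variables, let $\mathbf Z_1,\dots,\mathbf Z_N$ be fixed real square matrices of the same size and of rank $1$, and let $\mathbf A=\sum_{i=1}^N s_i\mathbf Z_i$. Then $$\text{(a)}\quad \mathbb E\big[\det(\mathbf A)\big]=\det\big(\mathbb E[\mathbf A]\big)\qquad\text{and}\qquad\text{(b)}\quad \mathbb E\big[\operatorname{adj}(\mathbf A)\big]=\operatorname{adj}\big(\mathbb E[\mathbf A]\big).$$
   Context: For a square matrix $\mathbf A$, $\operatorname{adj}(\mathbf A)$ denotes its adjugate: the matrix of the same size whose $(i,j)$ entry is $(-1)^{i+j}\det(\mathbf A_{-j,-i})$, where $\mathbf A_{-j,-i}$ is $\mathbf A$ without its $j$th row and $i$th column. Expectations of random matrices are taken entrywise. *)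

(* Defs.v *)
From HB Require Import structures.
From mathcomp Require Import all_boot all_order all_algebra.
From mathcomp Require Import all_classical all_reals all_analysis.

Set Implicit Arguments.
Unset Strict Implicit.
Unset Printing Implicit Defensive.

Import Order.TTheory GRing.Theory Num.Theory.

Local Open Scope classical_set_scope.
Local Open Scope ring_scope.
Local Open Scope ereal_scope.

(* Mutual (not merely pairwise) independence: the product rule is required for
   every subfamily J. *)
Definition independent_RVs (d : measure_display) (T : measurableType d)
    (R : realType) (P : probability T R) (I : finType)
    (X : I -> {RV P >-> R}) : Prop :=
  forall (J : {set I}) (B : I -> set R),
    (forall i, i \in J -> measurable (B i)) ->
    P (\bigcap_(i in [set` J]) (X i @^-1` B i)) =
    \prod_(i in J) P (X i @^-1` B i).

(* Entries are extended reals, as for ['E_P[_]]: an entry of M that is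
   measurable but not integrable has an infinite entry here. *)
Definition expectation_mx (d : measure_display) (T : measurableType d)
    (R : realType) (P : probability T R) (m n : nat)
    (M : T -> 'M[R]_(m, n)) : 'M[\bar R]_(m, n) :=
  \matrix_(i, j) 'E_P[fun w => M w i j].

(* Main.v *)
Require Import Defs.
From HB Require Import structures.
From mathcomp Require Import all_boot all_order all_algebra.
From mathcomp Require Import all_classical all_reals all_analysis.
From mathcomp Require Import perm measurable_realfun.

Set Implicit Arguments.
Unset Strict Implicit.
Unset Printing Implicit Defensive.

Import Order.TTheory GRing.Theory Num.Theory.

Local Open Scope classical_set_scope.
Local Open Scope ring_scope.

(* With [Z i = u i *m v i], row [k] of [\sum_i x i *: Z i] is
   [\sum_i (x i * u i k) *: v i]. Expanding the determinant by multilinearity in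
   the rows gives a sum over the maps [g] from rows to indices; if [g] is not
   injective two rows are proportional and the term vanishes, so the determinant
   is a polynomial in the [x i] whose monomials are squarefree. By independence,
   expectation commutes with squarefree monomials. A minor of a rank one matrix
   is again of the form [u *m v], which gives the adjugate. *)

(** * Determinants of linear combinations of outer products *)

Section determinant_expansion.
Variables (R : fieldType) (N n : nat).

Lemma rank1_outer (m : nat) (M : 'M[R]_(m, n)) :
  \rank M = 1%N -> exists (u : 'cV_m) (v : 'rV_n), M = u *m v.
Proof.
(* The two factors of the rank factorization are generalized first, so that their common dimension
   [\rank M] can be rewritten to 1. *)
move=> rM; move: (col_base M) (row_base M) (mulmx_base M).
by rewrite rM => u v <-; exists u, v.
Qed.

Definition outer_coef (u : 'I_N -> 'cV[R]_n) (v : 'I_N -> 'rV[R]_n)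
    (g : {ffun 'I_n -> 'I_N}) : R :=
  \prod_k u (g k) k 0 * \det (\matrix_k v (g k)).

(** Injectivity of [g] turns the product over the rows into a product over the image of [g], where
    each index occurs once; this is the form to which independence applies. Maps with the same image
    yield the same monomial and are not collected. *)
Lemma det_sum_outer (x : 'I_N -> R) (u : 'I_N -> 'cV[R]_n)
    (v : 'I_N -> 'rV[R]_n) :
  \det (\sum_i x i *: (u i *m v i)) =
  \sum_(g : {ffun 'I_n -> 'I_N} | injectiveb g)
     outer_coef u v g * \prod_(i in [set g k | k in 'I_n]%SET) x i.
Proof.
transitivity (\sum_(g : {ffun 'I_n -> 'I_N})
    outer_coef u v g * \prod_k x (g k)).
  rewrite /outer_coef /determinant.
  (* In the Leibniz formula, each product over rows of sums over [i] is distributed over all maps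
     [g]. Exchanging the sums leaves, for each [g], the Leibniz formula of the matrix with rows
     [v (g k)]. *)
  transitivity (\sum_(s : 'S_n) \sum_(g : {ffun 'I_n -> 'I_N})
     (-1) ^+ s * \prod_k (x (g k) * (u (g k) k 0 * v (g k) 0 (s k)))).
    apply: eq_bigr => s _; rewrite -big_distrr/=; congr (_ * _).
    rewrite -(bigA_distr_bigA (fun k i => x i * (u i k 0 * v i 0 (s k)))) /=.
    apply: eq_bigr => k _; rewrite summxE; apply: eq_bigr => i _.
    by rewrite !mxE big_ord1.
  rewrite exchange_big; apply: eq_bigr => /= g _.
  rewrite big_distrr big_distrl/=; apply: eq_bigr => s _.
  rewrite [in RHS]mulrCA -!mulrA; congr (_ * _); rewrite mulrCA -!big_split/=.
  by apply: eq_bigr => k _; rewrite !mxE mulrA mulrC [x _ * _]mulrC.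
rewrite (bigID (fun g : {ffun 'I_n -> 'I_N} => injectiveb g))/= addrC.
rewrite big1 ?add0r => [|g /injectivePn[k1 [k2 k12 gk]]]; last first.
  rewrite /outer_coef (determinant_alternate k12) ?mulr0 ?mul0r// => j.
  by rewrite !mxE gk.
apply: eq_bigr => g /injectiveP ginj; rewrite big_imset//=.
by move=> ? ? _ _; exact: ginj.
Qed.

End determinant_expansion.

(** * Weighted integrals of nonnegative functions of a random element *)

Section ge0_eq_integral.
Context d d' (T : measurableType d) (T' : measurableType d') (R : realType).
Variables (mu : {measure set T -> \bar R}) (X : T -> T').
Hypothesis mX : measurable_fun setT X.

Import HBNNSimple.

Let integral_compM_nnsfun (h : {nnsfun T' >-> R}) (G : T -> R) :
  measurable_fun setT G -> (forall w, 0 <= G w) ->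
  (\int[mu]_w (h (X w) * G w)%:E =
   \sum_(y \in range h)
      y%:E * \int[mu]_w (\1_(h @^-1` [set y]) (X w) * G w)%:E)%E.
Proof.
move=> mG G0.
have m1 y : measurable_fun setT (fun w => \1_(h @^-1` [set y]) (X w) : R).
  by apply: measurableT_comp => //; exact: measurable_indic.
have hG0 y w : (0 <= (y * \1_(h @^-1` [set y]) (X w) * G w)%:E)%E.
  by rewrite EFinM mule_ge0// ?lee_fin// -lee_fin nnfun_muleindic_ge0.
transitivity (\int[mu]_w \sum_(y \in range h)
    (y * \1_(h @^-1` [set y]) (X w) * G w)%:E)%E.
  apply: eq_integral => w _.
  rewrite fsumEFin//; congr EFin; rewrite (fimfunE h (X w)).
  by rewrite !fsbig_finite//= mulr_suml.
rewrite ge0_integral_fsum//; last first.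
  move=> y; apply/measurable_EFinP; apply: measurable_funM => //.
  by apply: measurable_funM.
apply: eq_fsbigr => y /[1!inE] -[x _ <-].
under eq_integral do rewrite -mulrA EFinM.
rewrite ge0_integralZl// ?lee_fin//.
- by apply/measurable_EFinP; exact: measurable_funM.
- by move=> w _; rewrite lee_fin mulr_ge0.
Qed.

(** Equality on indicators passes to simple functions by linearity, then to [f] by monotone
    convergence along simple functions increasing to [f]. Both sides may be infinite. *)
Lemma ge0_eq_integral_compM (G H : T -> R) :
  measurable_fun setT G -> (forall w, 0 <= G w) ->
  measurable_fun setT H -> (forall w, 0 <= H w) ->
  (forall B, measurable B -> \int[mu]_w (\1_B (X w) * G w)%:E =
                             \int[mu]_w (\1_B (X w) * H w)%:E)%E ->
  forall f : T' -> R, measurable_fun setT f -> (forall x, 0 <= f x) ->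
  (\int[mu]_w (f (X w) * G w)%:E = \int[mu]_w (f (X w) * H w)%:E)%E.
Proof.
move=> mG G0 mH H0 GH f mf f0.
have mEf : measurable_fun setT (EFin \o f) by exact/measurable_EFinP.
pose h := nnsfun_approx measurableT mEf.
have limh (K : T -> R) : measurable_fun setT K -> (forall w, 0 <= K w) ->
    (\int[mu]_w (f (X w) * K w)%:E =
     limn (fun n => \int[mu]_w (h n (X w) * K w)%:E))%E.
  move=> mK K0; rewrite -monotone_convergence//.
  - apply: eq_integral => w _; apply/esym/cvg_lim => //.
    rewrite EFinM; under eq_fun do rewrite EFinM.
    apply: cvgeZr => //.
    by apply: (cvg_nnsfun_approx measurableT mEf) => // x _; rewrite lee_fin.
  - move=> n; apply/measurable_EFinP; apply: measurable_funM => //.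
    exact: measurableT_comp.
  - by move=> n w _; rewrite lee_fin mulr_ge0.
  - move=> w _ m n mn; rewrite lee_fin ler_wpM2r//.
    exact/lefP/nd_nnsfun_approx.
rewrite !limh//; congr (limn _); apply/funext => n.
by rewrite !integral_compM_nnsfun//; apply: eq_fsbigr => y _; rewrite GH.
Qed.

End ge0_eq_integral.

(** * Expectations of products of independent variables *)

Section independent_product.
Context d (T : measurableType d) (R : realType) (P : probability T R).
Variables (I : finType) (s : I -> {RV P >-> R}).
Hypothesis s_indep : independent_RVs s.

(** Independence speaks of events only, that is, of indicator factors; these are replaced by general
    factors one at a time, by induction. Integrability makes every [fine] harmless. *)
Lemma independent_ge0_integral_prod (f : I -> R -> R) :
  (forall i, measurable_fun setT (f i)) -> (forall i x, 0 <= f i x) ->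
  (forall i, P.-integrable setT (EFin \o (f i \o s i))) ->
  (\int[P]_w (\prod_i f i (s i w))%:E =
   (\prod_i fine (\int[P]_w (f i (s i w))%:E))%:E)%E.
Proof.
have mfs (h : R -> R) i : measurable_fun setT h ->
    measurable_fun setT (fun w => h (s i w)).
  by move=> mh; exact: measurableT_comp.
suff main (r : seq I) : forall g : I -> R -> R,
    (forall i, measurable_fun setT (g i)) -> (forall i x, 0 <= g i x) ->
    (forall i, P.-integrable setT (EFin \o (g i \o s i))) ->
    (forall i, i \notin r -> exists2 B, measurable B & g i = \1_B) ->
  (\int[P]_w (\prod_i g i (s i w))%:E =
   (\prod_i fine (\int[P]_w (g i (s i w))%:E))%:E)%E.
  move=> mf f0 fint; apply: (main (enum I)) => // i.
  by rewrite mem_enum.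
(* The factors whose index is not in [r] are indicators; for [r = [::]] this is
   the definition of independence, and each step frees one factor. *)
elim: r => [|i0 r IH] {}f mf f0 fint fB.
  have /choice[B BP] : forall i, exists B, measurable B /\ f i = \1_B.
    by move=> i; have [//|B mB fi] := fB i; exists B.
  have mB i : measurable (B i) by case: (BP i).
  have fE i : f i = \1_(B i) by case: (BP i).
  have intE i : (\int[P]_w (f i (s i w))%:E = P (s i @^-1` B i))%E.
    rewrite fE -[in RHS](setIT (_ @^-1` _)) -integral_indic//.
    exact: measurable_funPTI.
  (* The product rule is taken for the full index set: the product of the indicators is the
     indicator of the intersection. *)
  have := @s_indep [set: I]%SET B (fun i _ => mB i).
  rewrite [X in _ = X -> _](eq_bigl predT); last first.
    by move=> i; rewrite finset.in_setT.
  have -> : (\prod_i P (s i @^-1` B i) =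
      (\prod_i fine (\int[P]_w (f i (s i w))%:E))%:E)%E.
    rewrite -prodEFin; apply: eq_bigr => i _.
    by rewrite fineK ?intE//; apply: fin_num_measure; exact: measurable_funPTI.
  move=> <-; rewrite -[in RHS](setIT (\bigcap_(_ in _) _)) -integral_indic//.
    apply: eq_integral => w _; congr EFin; rewrite indicE.
    have [/set_mem wB|wB] := boolP (w \in _).
      rewrite big1// => i _; rewrite fE indicE mem_set//.
      by apply: wB => /=; rewrite inE.
    have [i wBi] : exists i, ~ B i (s i w).
      apply: contrapT => /forallNP nB; move/negP: wB; apply.
      by apply/mem_set => i _; apply: contrapT; exact: nB.
    by rewrite (bigD1 i)//= fE indicE memNset// mul0r.
  by apply: fin_bigcap_measurable => // i _; exact: measurable_funPTI.
have cfin i : (\int[P]_w (f i (s i w))%:E)%E \is a fin_num.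
  exact: (integrable_fin_num _ (fint i)).
pose c := \prod_(i | i != i0) fine (\int[P]_w (f i (s i w))%:E)%E.
have c0 : 0 <= c.
  apply: prodr_ge0 => i _; rewrite fine_ge0// integral_ge0// => w _.
  by rewrite lee_fin.
pose G w := \prod_(i | i != i0) f i (s i w).
transitivity (\int[P]_w (f i0 (s i0 w) * G w)%:E)%E.
  by apply: eq_integral => w _; rewrite (bigD1 i0).
(* With the constant weight [c] in place of [G], the integral of the factor at [i0] splits off. It
   remains to compare the two weights on indicators of sets [B]. *)
rewrite (@ge0_eq_integral_compM _ _ _ _ _ _ _ _ G (cst c))//=.
- under eq_integral do rewrite EFinM.
  by rewrite (integralZr _ (fint i0))//= (bigD1 i0)//= -/c EFinM fineK.
- have -> : G = fun w =>
      \prod_(i <- [seq i <- index_enum I | i != i0]) f i (s i w).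
    by apply/funext => w; rewrite big_filter.
  by apply: measurable_prod => i _; exact: mfs.
- by move=> w; exact: prodr_ge0.
(* Putting an indicator at [i0] makes every factor outside [r] an indicator, so the induction
   hypothesis applies to [f']. *)
move=> B mB; pose f' i := if i == i0 then \1_B else f i.
have f'i0 : f' i0 = \1_B by rewrite /f' eqxx.
have f'N i : i != i0 -> f' i = f i by rewrite /f' => /negbTE ->.
have m1B : measurable_fun setT (\1_B : R -> R) by exact: measurable_indic.
have int1B : P.-integrable setT (EFin \o (\1_B \o s i0)).
  have -> : EFin \o (\1_B \o s i0) = EFin \o \1_(s i0 @^-1` B) by [].
  by apply: integrable_indic => //; exact: measurable_funPTI.
have := IH f'; rewrite (bigD1 i0)//= f'i0.
under eq_bigr do rewrite f'N//.
under eq_integral => w _.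
  rewrite (bigD1 i0)//= f'i0; under eq_bigr do rewrite f'N//.
  over.
move=> ->; last 4 first.
- by move=> i; rewrite /f'; case: ifPn.
- by move=> i x; rewrite /f'; case: ifPn.
- by move=> i; rewrite /f'; case: eqP => // ->.
- move=> i ir; rewrite /f'; case: eqP => [_|/eqP ii0]; first by exists B.
  by apply: fB; rewrite in_cons negb_or ii0.
under [RHS]eq_integral do rewrite EFinM.
by rewrite (integralZr _ int1B)//= EFinM fineK// (integrable_fin_num _ int1B).
Qed.

Lemma independent_integral_prod (f : I -> R -> R) :
  (forall i, measurable_fun setT (f i)) ->
  (forall i, P.-integrable setT (EFin \o (f i \o s i))) ->
  P.-integrable setT (fun w => (\prod_i f i (s i w))%:E) /\
  (\int[P]_w (\prod_i f i (s i w))%:E =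
   (\prod_i fine (\int[P]_w (f i (s i w))%:E))%:E)%E.
Proof.
move=> mf fint.
(* [x = (`|x| + x) - `|x|] is a difference of nonnegative functions of [x];
   expanding the product reduces to the nonnegative case. *)
pose p (b : bool) (x : R) := if b then `|x| else `|x| + x.
have pE x : x = \sum_(b : bool) (-1) ^+ b * p b x.
  by rewrite big_bool/= expr1 expr0 mulN1r mul1r addKr.
have p0 b x : 0 <= p b x.
  by case: b => //=; rewrite -lerBlDr sub0r -normrN ler_norm.
have mp b : measurable_fun setT (p b).
  by case: b => /=; [|apply: measurable_funD => //]; exact: normr_measurable.
have mpf b i : measurable_fun setT (p b \o f i) by exact: measurableT_comp.
have pint b i : P.-integrable setT (EFin \o ((p b \o f i) \o s i)).
  have Nint : P.-integrable setT (EFin \o (fun w => `|f i (s i w)|)).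
    exact: (integrable_norm (fint i)).
  case: b => //.
  exact: (integrableD _ Nint (fint i)).
have prodE (g : {ffun I -> bool}) := @independent_ge0_integral_prod
  (fun i => p (g i) \o f i) (fun i => mpf (g i) i) (fun i x => p0 (g i) (f i x))
  (fun i => pint (g i) i).
have prodint (g : {ffun I -> bool}) :
    P.-integrable setT (fun w => (\prod_i (p (g i) \o f i) (s i w))%:E).
  (* The product is nonnegative and [prodE] gives its integral as a real number, hence
     integrability. *)
  apply/integrableP; split.
    apply/measurable_EFinP; apply: measurable_prod => i _.
    exact: (measurableT_comp (mpf (g i) i)).
  under eq_integral => w _.
    rewrite gee0_abs; last first.
      by rewrite lee_fin; apply: prodr_ge0 => i _; exact: p0.
    over.
  by rewrite prodE ltry.
pose c (g : {ffun I -> bool}) : R := \prod_i (-1) ^+ g i.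
have expand w : (\prod_i f i (s i w))%:E = (\sum_(g : {ffun I -> bool})
    (c g)%:E * (\prod_i (p (g i) \o f i) (s i w))%:E)%E.
  under eq_bigr do rewrite [f _ _]pE.
  rewrite bigA_distr_bigA/= -sumEFin; apply: eq_bigr => g _.
  by rewrite big_split.
have cint (g : {ffun I -> bool}) : P.-integrable setT
    (fun w => (c g)%:E * (\prod_i (p (g i) \o f i) (s i w))%:E)%E.
  exact: integrableZl.
split; first by under eq_fun do rewrite expand; exact: integrable_sum.
under eq_integral do rewrite expand.
rewrite integral_sum//.
transitivity (\sum_(g : {ffun I -> bool}) (\prod_i ((-1) ^+ g i *
    fine (\int[P]_w ((p (g i) \o f i) (s i w))%:E)%E))%:E)%E.
  apply: eq_bigr => g _.
  by rewrite (integralZl _ (prodint g))// prodE -EFinM -big_split.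
(* Distributivity is now used backwards: the sum over [g] becomes a product over [i] of two-term
   sums, each of which is the integral of [f i (s i w)]. *)
rewrite sumEFin; congr EFin; rewrite -(bigA_distr_bigA (fun i (b : bool) =>
  (-1) ^+ b * fine (\int[P]_w ((p b \o f i) (s i w))%:E)%E)).
apply: eq_bigr => i _.
transitivity (fine (\int[P]_w \sum_(b : bool)
    (((-1) ^+ b)%:E * ((p b \o f i) (s i w))%:E))%E); last first.
  by congr fine; apply: eq_integral => w _; rewrite [f i _]pE -sumEFin.
rewrite integral_sum//; last by move=> b; exact: (integrableZl _ _ (pint b i)).
rewrite -sum_fine; last first.
  move=> b _; rewrite (integralZl _ (pint b i))// fin_numM//.
  exact: (integrable_fin_num _ (pint b i)).
apply: eq_bigr => b _; rewrite (integralZl _ (pint b i))// fineM//.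
exact: (integrable_fin_num _ (pint b i)).
Qed.

(** Factors outside [J] are taken to be the constant 1, which integrates to 1 under a probability;
    this reduces to the product over all indices. *)
Lemma independent_expectation_prod (J : {set I}) :
  (forall i, P.-integrable setT (EFin \o s i)) ->
  P.-integrable setT (fun w => (\prod_(i in J) s i w)%:E) /\
  'E_P[(fun w => \prod_(i in J) s i w)%R]%E =
  (\prod_(i in J) fine 'E_P[s i]%E)%:E.
Proof.
move=> s_int; pose f i (x : R) := if i \in J then x else 1.
have mf i : measurable_fun setT (f i) by rewrite /f; case: (i \in J).
have fint i : P.-integrable setT (EFin \o (f i \o s i)).
  rewrite /f /comp; case: (i \in J); first exact: s_int.
  exact: finite_measure_integrable_cst.
have prodJ w : \prod_(i in J) s i w = \prod_i f i (s i w).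
  by rewrite [LHS]big_mkcond.
have [prod_int prod_E] := independent_integral_prod mf fint.
split; first by under eq_fun do rewrite prodJ.
rewrite expectation.unlock; under eq_integral do rewrite prodJ.
rewrite prod_E; congr EFin; rewrite [RHS]big_mkcond/=.
apply: eq_bigr => i _; rewrite /f; case: ifP => // _.
rewrite integral_cst// mul1e; exact: (congr1 fine (probability_setT P)).
Qed.

End independent_product.

(** * Expectations of random determinants and matrices *)

Section expectation_det.
Context d (T : measurableType d) (R : realType) (P : probability T R).
Variables (N : nat) (s : 'I_N -> {RV P >-> R}).
Hypothesis s_indep : independent_RVs s.
Hypothesis s_int : forall i, P.-integrable setT (EFin \o s i).

(** Stated for arbitrary outer products because a minor of a rank one matrix may be zero but is
    still an outer product. Integrability is included so that the cofactor signs can later be taken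
    out of the integral. *)
Lemma expectation_det_sum_outer n (u : 'I_N -> 'cV[R]_n)
    (v : 'I_N -> 'rV[R]_n) :
  P.-integrable setT
    (fun w => (\det (\sum_i s i w *: (u i *m v i)))%:E) /\
  'E_P[(fun w => \det (\sum_i s i w *: (u i *m v i)))%R]%E =
  (\det (\sum_i fine 'E_P[s i]%E *: (u i *m v i)))%:E.
Proof.
have expand w : (\det (\sum_i s i w *: (u i *m v i)))%:E =
    (\sum_(g : {ffun 'I_n -> 'I_N} | injectiveb g) (outer_coef u v g)%:E *
      (\prod_(i in [set g k | k in 'I_n]%SET) s i w)%:E)%E.
  by rewrite det_sum_outer -sumEFin.
have gint (g : {ffun 'I_n -> 'I_N}) : P.-integrable setT (fun w =>
    (outer_coef u v g)%:E *
    (\prod_(i in [set g k | k in 'I_n]%SET) s i w)%:E)%E.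
  by apply: integrableZl => //; case: (independent_expectation_prod s_indep
    [set g k | k in 'I_n]%SET s_int).
split; first by under eq_fun do rewrite expand; exact: integrable_sum.
rewrite det_sum_outer expectation.unlock; under eq_integral do rewrite expand.
rewrite integral_sum// -sumEFin; apply: eq_bigr => g _.
have [Jint JE] := independent_expectation_prod s_indep
  [set g k | k in 'I_n]%SET s_int.
rewrite expectation.unlock in JE.
by rewrite integralZl// JE.
Qed.

Lemma expectation_mx_sum m n (Z : 'I_N -> 'M[R]_(m, n)) :
  map_mx fine (expectation_mx P (fun w => \sum_i s i w *: Z i)) =
  \sum_i fine 'E_P[s i]%E *: Z i.
Proof.
apply/matrixP => a b; rewrite !mxE summxE expectation.unlock.
have entryE w : ((\sum_i s i w *: Z i) a b)%:E =
    (\sum_i (Z i a b)%:E * (s i w)%:E)%E.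
  rewrite summxE -sumEFin; apply: eq_bigr => i _.
  by rewrite mxE -EFinM mulrC.
under eq_integral do rewrite entryE.
rewrite integral_sum//; last by move=> i; exact: (integrableZl _ _ (s_int i)).
have fin i : (\int[P]_w (s i w)%:E)%E \is a fin_num.
  exact: (integrable_fin_num _ (s_int i)).
(* As [fine] sends infinite values to 0, it commutes with the sum only once each summand is known to
   be finite. *)
rewrite -sum_fine; last first.
  by move=> i _; rewrite (integralZl _ (s_int i))// fin_numM//; exact: fin.
apply: eq_bigr => i _.
by rewrite mxE mulrC (integralZl _ (s_int i))// fineM//; exact: fin.
Qed.

End expectation_det.

Theorem lemma7 (R : realType) (d : measure_display) (T : measurableType d)
    (P : probability T R) (N n : nat)
    (s : 'I_N -> {RV P >-> R})
    (s_indep : independent_RVs s)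
    (s_int : forall i : 'I_N, P.-integrable [set: T] (EFin \o s i))
    (Z : 'I_N -> 'M[R]_n)
    (Z_rank1 : forall i : 'I_N, \rank (Z i) = 1%N)
    (A : T -> 'M[R]_n)
    (A_def : forall w : T, A w = \sum_(i < N) s i w *: Z i) :
  ('E_P[fun w => \det (A w)] =
     (\det (map_mx fine (expectation_mx P A)))%:E)%E /\
  expectation_mx P (fun w => \adj (A w)) =
     map_mx EFin (\adj (map_mx fine (expectation_mx P A))).
Proof.
have -> : A = fun w => \sum_i s i w *: Z i by exact/funext.
have /choice[u /choice[v Zuv]] : forall i, exists u : 'cV[R]_n,
    exists v : 'rV[R]_n, Z i = u *m v.
  by move=> i; exact: rank1_outer.
have sumE (x : 'I_N -> R) :
    \sum_i x i *: Z i = \sum_i x i *: (u i *m v i).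
  by apply: eq_bigr => i _; rewrite Zuv.
(* Deleting row [j] and column [i] of [u k *m v k] deletes entry [j] of [u k] and entry [i] of
   [v k]. The indices are swapped because the adjugate transposes the cofactors. *)
have minorE (x : 'I_N -> R) (i j : 'I_n) : \adj (\sum_i x i *: Z i) i j =
    (-1) ^+ (j + i) *
    \det (\sum_k x k *: (row' j (u k) *m col' i (v k))).
  rewrite mxE /cofactor; congr (_ * \det _); apply/matrixP => a b.
  rewrite !mxE !summxE; apply: eq_bigr => k _.
  by rewrite Zuv !mxE; congr (_ * _); apply: eq_bigr => l _; rewrite !mxE.
rewrite expectation_mx_sum//; split.
  rewrite sumE -(expectation_det_sum_outer s_indep s_int u v).2.
  by congr expectation; apply/funext => w; rewrite sumE.
apply/matrixP => i j; rewrite !mxE -/(cofactor _ _ _).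
have [minor_int minor_E] := expectation_det_sum_outer s_indep s_int
  (fun k => row' j (u k)) (fun k => col' i (v k)).
have := minorE (fun k => fine 'E_P[s k]%E) i j; rewrite mxE => ->.
(* The sign is a constant, so it moves inside the integral of the minor by [minor_int]; [minorE]
   then identifies the integrands pointwise. *)
rewrite EFinM -minor_E expectation.unlock -integralZl//.
by apply: eq_integral => w _; rewrite minorE EFinM.
Qed.
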